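(* There is no finite-dimensional nilpotent Lie algebra $L$ of nilpotency class $c\geq 3$ such that, with $n=\dim L$ and $m=\dim L^2$, one has $\dim \mathcal{M}(L)=\frac{1}{2}(n+m-2)(n-m-1)+1$. In particular, $\dim \mathcal{M}(L)\leq \frac{1}{2}(n+m-2)(n-m-1)$ for every $n$-dimensional nilpotent Lie algebra $L$ of nilpotency class $c\geq 3$ with $\dim L^2=m$.
   Context: Lie algebras are over a fixed field. $L^2=[L,L]$ is the derived subalgebra. The Schur multiplier of $L$ is the abelian Lie algebra $\mathcal{M}(L)=(R\cap F^2)/[R,F]$, where $L\cong F/R$ with $F$ a free Lie algebra (independent of the choice of free presentation up to isomorphism).
   Formalization: The formal theorem assumes that the fixed field does not have characteristic 3; over every field of characteristic 3 the claim fails for a 7-dimensional Lie algebra of class 3 with dim L^2 = 4 and dim M(L) = 10. *)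

(* Defs.v *)
From HB Require Import structures.
From mathcomp Require Import all_boot all_order all_algebra generic_quotient.
From mathcomp Require Import boolp classical_sets.

Set Implicit Arguments.
Unset Strict Implicit.
Unset Printing Implicit Defensive.

Import GRing.Theory.
Local Open Scope classical_set_scope.
Local Open Scope ring_scope.

HB.mixin Record Lmodule_isLie (K : fieldType) L of GRing.Lmodule K L := {
  lie : L -> L -> L;
  lie_linearl : forall (a : K) (u v w : L),
    lie (a *: u + v) w = a *: lie u w + lie v w;
  lie_linearr : forall (a : K) (u v w : L),
    lie u (a *: v + w) = a *: lie u v + lie u w;
  lie_alt : forall x : L, lie x x = 0;
  lie_jacobi : forall x y z : L,
    lie x (lie y z) + lie y (lie z x) + lie z (lie x y) = 0
}.

#[short(type="lieAlgType")]
HB.structure Definition LieAlgebra (K : fieldType) :=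
  {L of GRing.Lmodule K L & Lmodule_isLie K L}.

#[short(type="fdLieAlgType")]
HB.structure Definition FdLieAlgebra (K : fieldType) :=
  {L of Vector K L & LieAlgebra K L}.

Notation "[lie x , y ]" := (lie x y) (format "[lie  x ,  y ]").

Definition lie_morphism (K : fieldType) (A B : lieAlgType K) (f : A -> B) :=
  linear f /\ {morph f : x y / [lie x, y]}.

Definition subspace (K : fieldType) (V : lmodType K) (W : set V) :=
  W 0 /\ forall (a : K) u v, W u -> W v -> W (a *: u + v).

Definition lie_prod (K : fieldType) (L : lieAlgType K) (A B : set L) : set L :=
  smallest (@subspace K L) [set [lie a, b] | a in A & b in B].

(* For subspaces B `<=` A, the quotient A / B has dimension k: the classes of
   v 0, ..., v (k - 1) form a basis of it. *)
Definition quotient_dim (K : fieldType) (V : lmodType K) (A B : set V)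
    (k : nat) :=
  exists v : 'I_k -> V, (forall i, A (v i)) /\
    forall x, A x -> exists! c : 'rV[K]_k, B (x - \sum_i c 0 i *: v i).

Definition is_free_lie (K : fieldType) (X : Type) (F : lieAlgType K)
    (i : X -> F) :=
  forall (M : lieAlgType K) (f : X -> M),
    exists! phi : F -> M, lie_morphism phi /\ forall x, phi (i x) = f x.

Record free_presentation (K : fieldType) (L : lieAlgType K) :=
  FreePresentation {
    fp_index : Type;
    fp_alg : lieAlgType K;
    fp_gen : fp_index -> fp_alg;
    fp_free : is_free_lie fp_gen;
    fp_map : fp_alg -> L;
    fp_morphism : lie_morphism fp_map;
    fp_surj : forall y, exists x, fp_map x = y
  }.
Arguments fp_index {K L} P : rename.
Arguments fp_alg {K L} P : rename.
Arguments fp_gen {K L} P : rename.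
Arguments fp_map {K L} P : rename.

Definition fp_ker (K : fieldType) (L : lieAlgType K) (P : free_presentation L)
  : set (fp_alg P) := [set x | fp_map P x = 0].
Arguments fp_ker {K L} P.

(* The dimension of the Schur multiplier (R `&` F^2) / [R, F], computed from
   the free presentation L = F / R given by P. *)
Definition schur_multiplier_dim (K : fieldType) (L : lieAlgType K)
    (P : free_presentation L) (k : nat) :=
  quotient_dim (fp_ker P `&` lie_prod setT setT) (lie_prod (fp_ker P) setT) k.

Definition lie_prodv (K : fieldType) (L : fdLieAlgType K) (U V : {vspace L})
  : {vspace L} := <<[seq [lie u, v] | u <- vbasis U, v <- vbasis V]>>%VS.

Definition derived (K : fieldType) (L : fdLieAlgType K) : {vspace L} :=
  lie_prodv fullv fullv.

(* lcs L k is the term of index k + 1 of the usual numbering: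
   lcs L 0 = L, lcs L 1 = derived L. *)
Fixpoint lcs (K : fieldType) (L : fdLieAlgType K) (k : nat) : {vspace L} :=
  if k is k'.+1 then lie_prodv (lcs L k') fullv else fullv.

Definition nilpotent_of_class (K : fieldType) (L : fdLieAlgType K) (c : nat) :=
  lcs L c = 0%VS /\ forall k, (k < c)%N -> lcs L k <> 0%VS.

Section LieProdv.
Context (K : fieldType) (L : fdLieAlgType K).
Implicit Types U V : {vspace L}.

Lemma lie_prodvP U V :
  [set x | x \in lie_prodv U V] = lie_prod [set x | x \in U] [set x | x \in V].
Proof.
have l0 (w : L) : [lie 0, w] = 0.
  by have := lie_linearl (-1) 0 0 w; rewrite scaler0 addr0 scaleN1r addNr.
have r0 (w : L) : [lie w, 0] = 0.
  by have := lie_linearr (-1) w 0 0; rewrite scaler0 addr0 scaleN1r addNr.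
have lsum n (c : 'I_n -> K) (u : 'I_n -> L) w :
    [lie \sum_i c i *: u i, w] = \sum_i c i *: [lie u i, w].
  apply: (big_ind2 (fun x y => [lie x, w] = y)) => [// | x1 x2 y1 y2 <- <- | i _].
    by have := lie_linearl 1 x1 y1 w; rewrite !scale1r.
  by have := lie_linearl (c i) (u i) 0 w; rewrite !addr0 l0 addr0.
have rsum n (c : 'I_n -> K) (u : 'I_n -> L) w :
    [lie w, \sum_i c i *: u i] = \sum_i c i *: [lie w, u i].
  apply: (big_ind2 (fun x y => [lie w, x] = y)) => [// | x1 x2 y1 y2 <- <- | i _].
    by have := lie_linearr 1 w x1 y1; rewrite !scale1r.
  by have := lie_linearr (c i) w (u i) 0; rewrite !addr0 r0 addr0.
apply/seteqP; split=> [x /= xUV W [[W0 Wlin] WUV]|].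
  have {xUV}: x \in <<in_tuple
      [seq [lie u, v] | u <- vbasis U, v <- vbasis V]>>%VS by [].
  move=> /coord_span ->; elim/big_ind: _ => // [u v Wu Wv | i _].
    by rewrite -(scale1r u); apply: Wlin.
  rewrite -[_ *: _]addr0; apply: Wlin => //; apply: WUV.
  have /allpairsP[[u v] /= [uU vV ->]] := mem_nth 0 (ltn_ord i).
  by exists u; [exact: vbasis_mem | exists v => //; exact: vbasis_mem].
apply: smallest_sub => /=.
  by split=> [|a u v Wu Wv]; rewrite /= ?mem0v // memvD ?memvZ.
move=> _ [u /= uU [v /= vV <-]].
rewrite (coord_vbasis uU) (coord_vbasis vV) lsum.
apply: rpred_sum => i _; rewrite rsum; apply: rpredZ; apply: rpred_sum => j _.
apply/rpredZ/memv_span/allpairsP; exists ((vbasis U)`_i, (vbasis V)`_j).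
by split=> //=; apply: mem_nth; rewrite size_tuple.
Qed.

End LieProdv.

(* Existence of free Lie algebras, hence of free presentations: the free Lie
   algebra on X is the quotient of formal Lie expressions over X by the
   congruence generated by the axioms of Lie algebras. *)
Section FreeLie.
Local Open Scope quotient_scope.
Context (K : fieldType) (X : Type).

Inductive lterm : Type :=
| LGen of X
| LZero
| LAdd of lterm & lterm
| LScale of K & lterm
| LBr of lterm & lterm.

Inductive leqv : lterm -> lterm -> Prop :=
| leqv_refl t : leqv t t
| leqv_sym s t : leqv s t -> leqv t s
| leqv_trans s t u : leqv s t -> leqv t u -> leqv s u
| leqv_add s s' t t' : leqv s s' -> leqv t t' -> leqv (LAdd s t) (LAdd s' t')
| leqv_scale a t t' : leqv t t' -> leqv (LScale a t) (LScale a t')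
| leqv_br s s' t t' : leqv s s' -> leqv t t' -> leqv (LBr s t) (LBr s' t')
| leqv_addA s t u : leqv (LAdd s (LAdd t u)) (LAdd (LAdd s t) u)
| leqv_addC s t : leqv (LAdd s t) (LAdd t s)
| leqv_add0 t : leqv (LAdd LZero t) t
| leqv_addN t : leqv (LAdd (LScale (-1) t) t) LZero
| leqv_scaleA a b t : leqv (LScale a (LScale b t)) (LScale (a * b) t)
| leqv_scale1 t : leqv (LScale 1 t) t
| leqv_scaleDr a s t :
    leqv (LScale a (LAdd s t)) (LAdd (LScale a s) (LScale a t))
| leqv_scaleDl a b t :
    leqv (LScale (a + b) t) (LAdd (LScale a t) (LScale b t))
| leqv_brl a s t u :
    leqv (LBr (LAdd (LScale a s) t) u) (LAdd (LScale a (LBr s u)) (LBr t u))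
| leqv_brr a s t u :
    leqv (LBr s (LAdd (LScale a t) u)) (LAdd (LScale a (LBr s t)) (LBr s u))
| leqv_alt t : leqv (LBr t t) LZero
| leqv_jacobi s t u :
    leqv (LAdd (LAdd (LBr s (LBr t u)) (LBr t (LBr u s))) (LBr u (LBr s t)))
      LZero.

HB.instance Definition _ := gen_eqMixin lterm.
HB.instance Definition _ := gen_choiceMixin lterm.

Definition leqvb (s t : lterm) : bool := `[< leqv s t >].

Lemma leqvb_refl : reflexive leqvb.
Proof. by move=> t; apply/asboolP; constructor. Qed.

Lemma leqvb_sym : symmetric leqvb.
Proof. by move=> s t; apply/asboolP/asboolP; apply: leqv_sym. Qed.

Lemma leqvb_trans : transitive leqvb.
Proof.
by move=> t s u /asboolP st /asboolP tu; apply/asboolP; apply: leqv_trans tu.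
Qed.

Canonical leqv_equiv := EquivRel leqvb leqvb_refl leqvb_sym leqvb_trans.

Definition free_lie : Type := {eq_quot leqvb}.
HB.instance Definition _ := Choice.on free_lie.

Definition flpi (t : lterm) : free_lie := \pi_{eq_quot leqvb} t.
Definition flrep (x : free_lie) : lterm := repr (x : {eq_quot leqvb}).

Lemma flrepK x : flpi (flrep x) = x.
Proof. exact: reprK. Qed.

Lemma flpiP s t : flpi s = flpi t <-> leqv s t.
Proof. by split=> [/eqmodP/asboolP|st] //; apply/eqmodP/asboolP. Qed.

Lemma leqv_rep t : leqv (flrep (flpi t)) t.
Proof. by apply/flpiP; rewrite flrepK. Qed.

Definition fladd x y := flpi (LAdd (flrep x) (flrep y)).
Definition flscale a x := flpi (LScale a (flrep x)).
Definition flbr x y := flpi (LBr (flrep x) (flrep y)).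
Definition flopp x := flscale (-1) x.

Lemma fladdE s t : fladd (flpi s) (flpi t) = flpi (LAdd s t).
Proof. by apply/flpiP/leqv_add; apply: leqv_rep. Qed.
Lemma flscaleE a t : flscale a (flpi t) = flpi (LScale a t).
Proof. by apply/flpiP/leqv_scale; apply: leqv_rep. Qed.
Lemma flbrE s t : flbr (flpi s) (flpi t) = flpi (LBr s t).
Proof. by apply/flpiP/leqv_br; apply: leqv_rep. Qed.

Let flE := (fladdE, flscaleE, flbrE).

Lemma fladdA : associative fladd.
Proof.
move=> x y z; rewrite -[x]flrepK -[y]flrepK -[z]flrepK !flE.
exact/flpiP/leqv_addA.
Qed.
Lemma fladdC : commutative fladd.
Proof.
by move=> x y; rewrite -[x]flrepK -[y]flrepK !flE; apply/flpiP/leqv_addC.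
Qed.
Lemma fladd0 : left_id (flpi LZero) fladd.
Proof. by move=> x; rewrite -[x]flrepK !flE; apply/flpiP/leqv_add0. Qed.
Lemma fladdN : left_inverse (flpi LZero) flopp fladd.
Proof. by move=> x; rewrite -[x]flrepK /flopp !flE; apply/flpiP/leqv_addN. Qed.

HB.instance Definition _ :=
  GRing.isZmodule.Build free_lie fladdA fladdC fladd0 fladdN.

Lemma flscaleA a b x : flscale a (flscale b x) = flscale (a * b) x.
Proof. by rewrite -[x]flrepK !flE; apply/flpiP/leqv_scaleA. Qed.
Lemma flscale1 : left_id 1 flscale.
Proof. by move=> x; rewrite -[x]flrepK !flE; apply/flpiP/leqv_scale1. Qed.
Lemma flscaleDr : right_distributive flscale +%R.
Proof.
move=> a x y; rewrite -[x]flrepK -[y]flrepK /GRing.add /= !flE.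
exact/flpiP/leqv_scaleDr.
Qed.
Lemma flscaleDl x : {morph flscale^~ x : a b / a + b}.
Proof.
move=> a b; rewrite -[x]flrepK [RHS]/GRing.add /= !flE.
exact/flpiP/leqv_scaleDl.
Qed.

HB.instance Definition _ := GRing.Zmodule_isLmodule.Build K free_lie
  flscaleA flscale1 flscaleDr flscaleDl.

Lemma flD s t : flpi s + flpi t = flpi (LAdd s t). Proof. exact: fladdE. Qed.
Lemma flZ a t : a *: flpi t = flpi (LScale a t). Proof. exact: flscaleE. Qed.

Lemma flbr_linearl a u v w : flbr (a *: u + v) w = a *: flbr u w + flbr v w.
Proof.
rewrite -[u]flrepK -[v]flrepK -[w]flrepK flZ flD !flbrE flZ flD.
exact/flpiP/leqv_brl.
Qed.
Lemma flbr_linearr a u v w : flbr u (a *: v + w) = a *: flbr u v + flbr u w.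
Proof.
rewrite -[u]flrepK -[v]flrepK -[w]flrepK flZ flD !flbrE flZ flD.
exact/flpiP/leqv_brr.
Qed.
Lemma flbr_alt x : flbr x x = 0.
Proof. by rewrite -[x]flrepK flbrE; apply/flpiP/leqv_alt. Qed.
Lemma flbr_jacobi x y z :
  flbr x (flbr y z) + flbr y (flbr z x) + flbr z (flbr x y) = 0.
Proof.
rewrite -[x]flrepK -[y]flrepK -[z]flrepK !flbrE !flD.
exact/flpiP/leqv_jacobi.
Qed.

HB.instance Definition _ := Lmodule_isLie.Build K free_lie
  flbr_linearl flbr_linearr flbr_alt flbr_jacobi.

Lemma flL s t : [lie flpi s, flpi t] = flpi (LBr s t). Proof. exact: flbrE. Qed.

Definition flgen (x : X) : free_lie := flpi (LGen x).

Fixpoint leval (M : lieAlgType K) (f : X -> M) (t : lterm) : M :=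
  match t with
  | LGen x => f x
  | LZero => 0
  | LAdd s t => leval f s + leval f t
  | LScale a t => a *: leval f t
  | LBr s t => [lie leval f s, leval f t]
  end.

Lemma leval_eqv (M : lieAlgType K) (f : X -> M) s t :
  leqv s t -> leval f s = leval f t.
Proof.
elim=> //= {s t}.
- by move=> s t u _ -> _ ->.
- by move=> s s' t t' _ -> _ ->.
- by move=> a t t' _ ->.
- by move=> s s' t t' _ -> _ ->.
- by move=> s t u; rewrite addrA.
- by move=> s t; rewrite addrC.
- by move=> t; rewrite add0r.
- by move=> t; rewrite scaleN1r addNr.
- by move=> a b t; rewrite scalerA.
- by move=> t; rewrite scale1r.
- by move=> a s t; rewrite scalerDr.
- by move=> a b t; rewrite scalerDl.
- by move=> a s t u; rewrite lie_linearl.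
- by move=> a s t u; rewrite lie_linearr.
- by move=> t; rewrite lie_alt.
- by move=> s t u; rewrite lie_jacobi.
Qed.

Lemma free_lie_is_free : is_free_lie (F := free_lie) flgen.
Proof.
move=> M f; exists (fun x => leval f (flrep x)).
have ev t : leval f (flrep (flpi t)) = leval f t.
  exact/leval_eqv/leqv_rep.
split=> [|phi [[philin phibr] phigen]].
  split=> [|x]; last by rewrite ev.
  split=> [a x y|x y].
    by rewrite -[x]flrepK -[y]flrepK flZ flD !ev.
  by rewrite -[x]flrepK -[y]flrepK flL !ev.
apply/funext=> x; rewrite -{2}[x]flrepK; elim: (flrep x) => /=.
- by move=> y; rewrite phigen.
- by have := philin (-1) 0 0; rewrite scaler0 addr0 scaleN1r addNr.
- move=> s -> t ->; rewrite -flD.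
  by have := philin 1 (flpi s) (flpi t); rewrite !scale1r.
- move=> a t ->; rewrite -flZ.
  have phi0 : phi 0 = 0.
    by have := philin (-1) 0 0; rewrite scaler0 addr0 scaleN1r addNr.
  by have := philin a (flpi t) 0; rewrite !addr0 phi0 addr0.
- by move=> s -> t ->; rewrite -flL; have -> := phibr (flpi s) (flpi t).
Qed.

End FreeLie.

Lemma free_presentation_exists (K : fieldType) (L : lieAlgType K) :
  inhabited (free_presentation L).
Proof.
have freeL := @free_lie_is_free K L.
have [phi [[phiM phi_gen] _]] := freeL L id.
by split; exact: (FreePresentation freeL phiM (fun y => ex_intro _ _ (phi_gen y))).
Qed.

(* Main.v *)
Require Import Defs.
From HB Require Import structures.
From mathcomp Require Import all_boot all_order all_algebra.
From mathcomp Require Import boolp classical_sets.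
From mathcomp Require Import zify ring lra.
Import GRing.Theory.
Local Open Scope ring_scope.

(* The bracket of F/[R, F] depends only on classes in L = F/R, so choosing a
   linear section L -> F turns it into an alternating 2-cocycle b on L whose
   values span a space of dimension dim M(L) + m.  Let P_i be the span of
   b(gamma_i L, L) and d = n - m.  Alternation gives dim P_1/P_2 <= C(d, 2), and
   b induces surjections
     (gamma_i L / gamma_(i+1) L) (x) (L / L^2) -> P_i / P_(i+1),  i >= 2,
   whose sources have total dimension m d.  The cocycle identity puts d - 2
   independent Jacobi tensors in the kernel for i = 2 and, when the class is at
   least 3 and 3 is invertible, a nonzero tensor in the kernel for i = 3.  Hence
     dim M(L) + m <= C(d, 2) + m d - (d - 1),
   which is the announced bound. *)

(** * Bilinear maps, the Lie bracket, and spans of values *)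

Lemma alternating_opp {K : fieldType} {A C : lmodType K}
    (b : {bilinear A -> A -> C}) (x y : A) :
  (forall u, b u u = 0) -> b x y = - b y x.
Proof.
move=> balt; apply/eqP; rewrite -addr_eq0; apply/eqP; have := balt (x + y).
by rewrite linearDl /= !linearDr /= !balt add0r addr0.
Qed.

Section LieBilinear.
Context {K : fieldType} {L : lieAlgType K}.

Lemma lie_is_bilinear :
  bilinear_for ( *:%R : K -> L -> L) ( *:%R : K -> L -> L) (@lie K L).
Proof.
by split=> w a u v; [apply: lie_linearl | apply: lie_linearr].
Qed.

HB.instance Definition _ := bilinear_isBilinear.Build K L L L *:%R *:%R
  (@lie K L) lie_is_bilinear.

Lemma lieC (x y : L) : [lie x, y] = - [lie y, x].
Proof. exact: (alternating_opp (@lie K L) x y (@lie_alt K L)). Qed.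

Lemma lie_jacobi_left (x y z : L) :
  [lie [lie x, y], z] + [lie [lie y, z], x] + [lie [lie z, x], y] = 0.
Proof.
have := lie_jacobi z x y.
rewrite (lieC z) (lieC x [lie _, _]) (lieC y [lie _, _]) -!opprD.
by move/eqP; rewrite oppr_eq0 => /eqP.
Qed.

End LieBilinear.

Section BilinearSpan.
Context {K : fieldType} {A B C : vectType K} (f : {bilinear A -> B -> C}).
Implicit Types (U : {vspace A}) (V : {vspace B}) (W : {vspace C}).

Definition bilinear_span U V : {vspace C} :=
  <<[seq f u v | u <- vbasis U, v <- vbasis V]>>%VS.

Lemma mem_bilinear_span U V u v :
  u \in U -> v \in V -> f u v \in bilinear_span U V.
Proof.
move=> uU vV; rewrite (coord_vbasis uU) (coord_vbasis vV).
rewrite linear_sumlz; apply: rpred_sum => i _.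
rewrite linear_sumr; apply: rpred_sum => j _.
rewrite linearZl_LR linearZr_LR; do 2!apply: rpredZ.
apply/memv_span/allpairsP; exists ((vbasis U)`_i, (vbasis V)`_j).
by split=> //=; apply: mem_nth; rewrite size_tuple.
Qed.

Lemma bilinear_span_subv U V W :
  (forall u v, u \in U -> v \in V -> f u v \in W) ->
  (bilinear_span U V <= W)%VS.
Proof.
move=> fW; apply/span_subvP => _ /allpairsP[[u v] /= [uU vV ->]].
by apply: fW; apply: vbasis_mem.
Qed.

End BilinearSpan.

Lemma lie_prodvE (K : fieldType) (L : fdLieAlgType K) (U V : {vspace L}) :
  lie_prodv U V = bilinear_span (@lie K L) U V.
Proof. by []. Qed.

(** * Coordinates on quotients and dimension estimates for spans *)

Lemma linfunE {K : fieldType} {A B : vectType K} {h : A -> B} :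
  linear h -> linfun h =1 h.
Proof.
move=> hlin; pose h' := GRing.isLinear.Build K A B _ h hlin.
pose hL : {linear A -> B} := HB.pack h h'.
exact: (lfunE hL).
Qed.

(** The complement [U :\: V] supplies the representatives [y]; [f] reads the coordinates of the
    component there, and the error is the component in [V]. *)
Lemma quotient_chart {K : fieldType} {A : vectType K} {U V : {vspace A}} :
  (V <= U)%VS ->
  exists (f : 'Hom(A, 'rV[K]_(\dim U - \dim V))) (y : 'I__ -> A),
    (forall j, y j \in U) /\
    (forall u, u \in U -> u - \sum_j f u 0 j *: y j \in V).
Proof.
move=> VU; have dimC : \dim (U :\: V) = (\dim U - \dim V)%N.
  by have := dimv_cap_compl U V; rewrite (capv_idPr VU) => <-; rewrite addKn.
rewrite -dimC.
exists (linfun (fun u => \row_j coord (vbasis (U :\: V)) j (addv_pi1 U V u))).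
exists (fun j => (vbasis (U :\: V))`_j); split=> [j|u uU].
  apply: (subvP (diffvSl U V)); apply: vbasis_mem.
  by apply: mem_nth; rewrite size_tuple.
rewrite linfunE => [|a v w]; last first.
  by apply/rowP=> j; rewrite !mxE !linearP.
under eq_bigr do rewrite mxE.
rewrite -(coord_vbasis (memv_pi (U :\: V) V u)).
rewrite -{1}(@addv_pi1_pi2 _ _ U V u); last by rewrite (subvP (addvSl U V)).
by rewrite addrC addKr memv_pi2.
Qed.

(* Here y and f are representatives of a basis of U / U' and the coordinates on
   it, and likewise x and g for V / V', so that matrices stand for elements of
   U/U' (x) V/V' and tensor_map is the map induced by b, modulo W. *)
Section Tensor.
Context {K : fieldType} {A B C : vectType K} (b : {bilinear A -> B -> C}).
Context {U U' : {vspace A}} {V V' : {vspace B}} {W : {vspace C}}.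
Context {r d : nat}.
Context {f : 'Hom(A, 'rV[K]_r)} {y : 'I_r -> A} (yU : forall j, y j \in U).
Context (fP : forall u, u \in U -> u - \sum_j f u 0 j *: y j \in U').
Context {g : 'Hom(B, 'rV[K]_d)} {x : 'I_d -> B}.
Context (gP : forall v, v \in V -> v - \sum_k g v 0 k *: x k \in V').
Context (bUV' : forall u v, u \in U -> v \in V' -> b u v \in W).
Context (bU'V : forall u v, u \in U' -> v \in V -> b u v \in W).

Definition tensor_map : 'Hom('M[K]_(r, d), C) :=
  linfun (fun M : 'M[K]_(r, d) => \sum_j \sum_k M j k *: b (y j) (x k)).

Lemma tensor_mapE (M : 'M[K]_(r, d)) :
  tensor_map M = \sum_j \sum_k M j k *: b (y j) (x k).
Proof.
rewrite linfunE // => a M1 M2.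
rewrite scaler_sumr -big_split /=; apply: eq_bigr => j _.
rewrite scaler_sumr -big_split /=; apply: eq_bigr => k _.
by rewrite !mxE scalerDl scalerA.
Qed.

Lemma bilinear_coord_sum u v :
  u \in U -> v \in V ->
  b u v - \sum_j \sum_k (f u 0 j * g v 0 k) *: b (y j) (x k) \in W.
Proof.
move=> uU vV.
have -> : \sum_j \sum_k (f u 0 j * g v 0 k) *: b (y j) (x k) =
    b (\sum_j f u 0 j *: y j) (\sum_k g v 0 k *: x k).
  rewrite linear_sumlz; apply: eq_bigr => j _.
  rewrite linear_sumr; apply: eq_bigr => k _.
  by rewrite linearZl_LR linearZr_LR /= scalerA.
set u' := \sum_j _; set v' := \sum_k _.
have -> : b u v - b u' v' = b (u - u') v + b u' (v - v').
  by rewrite linearBl linearBr /= addrA subrK.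
apply: rpredD; first by apply: bU'V => //; apply: fP.
apply: bUV'; last exact: gP.
by apply: rpred_sum => j _; apply: rpredZ.
Qed.

Lemma tensor_mapP u v :
  u \in U -> v \in V -> b u v - tensor_map ((f u)^T *m g v) \in W.
Proof.
move=> uU vV; rewrite tensor_mapE.
under eq_bigr => j _ do under eq_bigr => k _ do
  rewrite mxE big_ord1 mxE.
exact: bilinear_coord_sum.
Qed.

(** Modulo [W] the span lies in the image of [T]. Rank-nullity on all matrices gives at most
    [r * d], and the part of [S] not killed by [T] is absorbed by the intersection of that image
    with [W]. *)
Lemma dim_bilinear_span_step (S : {vspace 'M[K]_(r, d)}) :
  (forall M, M \in S -> tensor_map M \in W) ->
  (\dim (bilinear_span b U V) + \dim S <= \dim W + r * d)%N.
Proof.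
move=> TS; set T := tensor_map.
have PW : (bilinear_span b U V <= limg T + W)%VS.
  apply: bilinear_span_subv => u v uU vV.
  rewrite -[b u v](subrK (T ((f u)^T *m g v))) addrC.
  by rewrite memv_add ?memv_img ?memvf ?tensor_mapP.
have dimT := limg_ker_dim T fullv.
rewrite capfv dimvf /dim /= in dimT.
have dimTW := dimv_sum_cap (limg T) W.
have dimS := limg_ker_dim T S.
have SW : (T @: S <= limg T :&: W)%VS.
  rewrite subv_cap limgS ?subvf //=.
  by apply/subvP => _ /memv_imgP[M MS ->]; apply: TS.
rewrite -dimT -dimS addnA.
have leST := dimvS (capvSr S (lker T)).
apply: leq_trans (leq_add (leq_add (dimvS PW) leST) (dimvS SW)) _.
by rewrite addnAC dimTW addnC [leqRHS]addnC addnA.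
Qed.

End Tensor.

(** Modulo [W] only the values [b (y j) (y k)] at representatives of a basis of the quotient by [V]
    count, and alternation leaves the pairs with [j < k]. *)
Lemma dim_alternating_span {K : fieldType} {A C : vectType K}
    (b : {bilinear A -> A -> C}) (V : {vspace A}) (W : {vspace C}) :
  (forall u, b u u = 0) ->
  (forall u v, v \in V -> b u v \in W) ->
  (\dim (bilinear_span b fullv fullv) <= \dim W + 'C(\dim {:A} - \dim V, 2))%N.
Proof.
move=> balt bV.
have bC u v : b u v = - b v u by apply: alternating_opp.
have [f [y [_ fP]]] := quotient_chart (subvf V).
set d := (_ - _)%N in f y fP *.
pose D := (\sum_(k < d) \sum_(j < d | (j < k)%N) <[b (y j) (y k)]>)%VS.
have dimD : (\dim D <= 'C(d, 2))%N.
  apply: (leq_trans (dimv_leq_sum _ _ _)); rewrite -bin2_sum big_mkord.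
  apply: leq_sum => k _; apply: (leq_trans (dimv_leq_sum _ _ _)).
  rewrite -{2}(card_ord k) -sum1_card.
  rewrite (big_ord_widen d (fun=> 1)%N (ltnW (ltn_ord k))).
  by apply: leq_sum => j _; rewrite dim_vline leq_b1.
have bD j k : b (y j) (y k) \in D.
  wlog lejk : j k / (j <= k)%N => [H|].
    by case/orP: (leq_total j k) => /H // kj; rewrite bC rpredN.
  move: lejk; rewrite leq_eqVlt => /orP[/eqP/val_inj->|ltjk].
    by rewrite balt mem0v.
  apply: (subvP (sumv_sup k _ (sumv_sup j ltjk (subvv _)))) => //.
  exact: memv_line.
suff PWD : (bilinear_span b fullv fullv <= W + D)%VS.
  apply: (leq_trans (dimvS PWD)); apply: (leq_trans (dimv_add_leqif _ _).1).
  by rewrite leq_add2l.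
apply: bilinear_span_subv => u v _ _.
set s := \sum_j \sum_k (f u 0 j * f v 0 k) *: b (y j) (y k).
rewrite -[b u v](subrK s); apply: memv_add.
  apply: (bilinear_coord_sum _ (U := fullv) _ fP fP) => *; rewrite ?memvf //.
    exact: bV.
  by rewrite bC rpredN bV.
by do 2![apply: rpred_sum => ? _]; apply: rpredZ.
Qed.

(** * The lower central series *)

Section LowerCentralSeries.
Context {K : fieldType} {L : fdLieAlgType K}.
Implicit Types (x y z : L) (i c : nat).

Lemma mem_lcsS i x y : x \in lcs L i -> [lie x, y] \in lcs L i.+1.
Proof. by move=> xi; rewrite /= lie_prodvE mem_bilinear_span ?memvf. Qed.

Lemma lcs_subvS i : (lcs L i.+1 <= lcs L i)%VS.
Proof.
elim: i => [|i IHi]; first exact: subvf.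
by apply: bilinear_span_subv => u v ui _; apply/mem_lcsS/(subvP IHi).
Qed.

Lemma lcs_subv i j : (i <= j)%N -> (lcs L j <= lcs L i)%VS.
Proof.
move=> /subnKC <-; elim: (j - i)%N => [|k IHk]; first by rewrite addn0.
by rewrite addnS; apply: subv_trans IHk; apply: lcs_subvS.
Qed.

(** Once two consecutive terms agree the series is constant, so it could not be nonzero at [i] and
    zero at [c]. *)
Lemma lcs_proper i c :
  nilpotent_of_class L c -> (i < c)%N -> ~~ (lcs L i <= lcs L i.+1)%VS.
Proof.
move=> [Lc0 Lneq0] ltic; apply/negP => stable.
have eqS : lcs L i.+1 = lcs L i.
  by apply/eqP; rewrite eqEsubv lcs_subvS stable.
have eqk k : lcs L (i + k) = lcs L i.
  by elim: k => [|k IHk]; rewrite ?addn0 // addnS /= IHk; apply: eqS.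
by apply: (Lneq0 i) => //; rewrite -Lc0 -(subnKC (ltnW ltic)) eqk.
Qed.

(* If [[x, y], x] were always in the next term, [[x, y], z] would be
   alternating modulo that term, and the Jacobi identity would give
   3 [[x, y], z] = 0 there. *)
Lemma exists_lie_lie_notin c : 3%N \notin [pchar K] ->
  nilpotent_of_class L c -> (3 <= c)%N ->
  exists x y, [lie [lie x, y], x] \notin lcs L 3.
Proof.
move=> char3 nilL le3c; have := lcs_proper 2 c nilL le3c.
apply: contraNP => /forallNP Engel.
have {}Engel x y : [lie [lie x, y], x] \in lcs L 3.
  by apply/negPn/negP => xyx; apply: (Engel x); exists y.
set I3 := lcs L 3 in Engel *.
(* Polarization of [Engel] at [x + z]. *)
have t_asym x y z : [lie [lie x, y], z] + [lie [lie z, y], x] \in I3.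
  have := Engel (x + z) y.
  rewrite (linearDl (@lie K L)) linearDl /= !linearDr /= -addrA.
  by rewrite rpredDl ?Engel // addrA rpredDr ?Engel.
have t_cycl x y z : [lie [lie y, z], x] - [lie [lie x, y], z] \in I3.
  have := t_asym x y z; rewrite -rpredN opprD addrC.
  by rewrite (lieC z y) linearNl opprK.
have t3 x y z : [lie [lie x, y], z] \in I3.
  have three_neq0 : (3%:R : K) != 0 by move: char3; rewrite inE.
  suff t3 : 3%:R *: [lie [lie x, y], z] \in I3.
    by rewrite -[[lie _, z]](scalerK three_neq0) rpredZ.
  have := mem0v I3; rewrite -(lie_jacobi_left x y z).
  rewrite -(subrK [lie [lie y, z], x] [lie [lie z, x], y]).
  rewrite addrCA rpredDl ?t_cycl //.
  rewrite -(subrK [lie [lie x, y], z] [lie [lie y, z], x]).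
  rewrite addrCA rpredDl ?t_cycl // (addrCA [lie [lie x, y], z]) -addrA.
  by rewrite rpredDl ?t_cycl // scaler_nat mulrSr mulr2n.
apply: bilinear_span_subv => u v uL1 _.
(* Elements of [lcs L 1] are only sums of brackets, so [t3] is extended to them through the preimage
   of [I3] under a linear map. *)
have /subvP/(_ u uL1) : (lcs L 1 <= (linfun (@lie K L ^~ v)) @^-1: I3)%VS.
  apply: bilinear_span_subv => x y _ _.
  by rewrite -memv_preim linfunE ?t3 // => a w w'; rewrite lie_linearl.
by rewrite -memv_preim linfunE // => a w w'; rewrite lie_linearl.
Qed.

End LowerCentralSeries.

(** * Bounding the span of an alternating 2-cocycle *)

Section Cocycle.
Context {K : fieldType} {L : fdLieAlgType K} {Q : vectType K}.
Context (b : {bilinear L -> L -> Q}) (balt : forall x, b x x = 0).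
Context (bcocycle : forall x y z,
  b [lie x, y] z + b [lie y, z] x + b [lie z, x] y = 0).
Implicit Types (x y z u v : L) (i c : nat).

Let d := (\dim {:L} - \dim (derived L))%N.
(* P_(i+1) in the notation above, just as lcs L i is gamma_(i+1) L. *)
Let span_lcs i := bilinear_span b (lcs L i) fullv.

Lemma mem_span_lcs i u v : u \in lcs L i -> b u v \in span_lcs i.
Proof. by move=> ui; apply: mem_bilinear_span (memvf _). Qed.

(** For [v = [x, y]] the cocycle identity trades [b [x, y] u] for [b [y, u] x] and [b [u, x] y],
    whose first arguments lie in [lcs L i.+1]. This lets the second tensor factor be [L / L^2]. *)
Lemma cocycle_lcs_derived i u v :
  u \in lcs L i -> v \in derived L -> b u v \in span_lcs i.+1.
Proof.
move=> ui; have blin : linear (b u) by move=> a w w'; rewrite linearPr.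
have /subvP H : (derived L <= (linfun (b u)) @^-1: span_lcs i.+1)%VS.
  apply: bilinear_span_subv => x y _ _.
  rewrite -memv_preim linfunE //; have /eqP := bcocycle x y u.
  rewrite -addrA addr_eq0 => /eqP xyu.
  rewrite alternating_opp // xyu opprK lieC linearNl /=.
  by rewrite rpredD ?rpredN ?mem_span_lcs ?mem_lcsS.
by move/H; rewrite -memv_preim linfunE.
Qed.

(** The tensor step for [lcs L i / lcs L i.+1] and [L / L^2]. Of the coordinates [f] and [g] only
    the control of their kernels is kept; by the last clause, each independent tensor sent into
    [span_lcs i.+1] lowers the bound by one. *)
Lemma lcs_chart i :
  exists (r := (\dim (lcs L i) - \dim (lcs L i.+1))%N)
    (f : 'Hom(L, 'rV[K]_r)) (g : 'Hom(L, 'rV[K]_d))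
    (T : 'Hom('M[K]_(r, d), Q)),
  [/\ forall u, u \in lcs L i -> f u = 0 -> u \in lcs L i.+1,
      forall v, g v = 0 -> v \in derived L,
      forall u v, u \in lcs L i ->
        b u v - T ((f u)^T *m g v) \in span_lcs i.+1 &
      forall S : {vspace _}, (forall M, M \in S -> T M \in span_lcs i.+1) ->
        (\dim (span_lcs i) + \dim S <= \dim (span_lcs i.+1) + r * d)%N].
Proof.
move=> r.
have [f [y [yi fP]]] := quotient_chart (lcs_subvS (L := L) i).
have [g [x [_ gP]]] := quotient_chart (subvf (derived L)).
have bL u v : u \in lcs L i -> v \in derived L -> b u v \in span_lcs i.+1.
  exact: cocycle_lcs_derived.
have bR u v : u \in lcs L i.+1 -> v \in fullv -> b u v \in span_lcs i.+1.
  by move=> ui _; apply: mem_span_lcs.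
exists f, g, (tensor_map b (y := y) (x := x)); split.
- move=> u ui fu0; have := fP u ui.
  by rewrite fu0 big1 ?subr0 // => j _; rewrite mxE scale0r.
- move=> v gv0; have := gP v (memvf v).
  by rewrite gv0 big1 ?subr0 // => j _; rewrite mxE scale0r.
- by move=> u v ui; apply: (tensor_mapP b yi fP gP bL bR); rewrite ?memvf.
- by move=> S; apply: (dim_bilinear_span_step b yi fP gP bL bR).
Qed.

(** Telescopes the step of [lcs_chart] with [S = 0], by induction on [c - i]; from [c] on both sides
    vanish. *)
Lemma dim_span_lcs_leq c i :
  lcs L c = 0%VS -> (\dim (span_lcs i) <= \dim (lcs L i) * d)%N.
Proof.
move=> Lc0; have [k] := ubnP (c - i); elim: k i => // k IHk i lt_ci.
have [le_ci | lt_ic] := leqP c i.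
  have -> : lcs L i = 0%VS by apply/eqP; rewrite -subv0 -Lc0 lcs_subv.
  suff -> : span_lcs i = 0%VS by rewrite dimv0.
  apply/eqP; rewrite -subv0; apply: bilinear_span_subv => u v ui _.
  have : u \in 0%VS by apply: subvP ui; rewrite -Lc0 lcs_subv.
  by rewrite memv0 => /eqP->; rewrite linear0l mem0v.
have [f [g [T [_ _ _ step]]]] := lcs_chart i.
have := step 0%VS; rewrite dimv0 addn0 => /(_ _)/leq_trans-> //.
  by move=> M; rewrite memv0 => /eqP->; rewrite linear0 mem0v.
rewrite -[X in (_ <= X * d)%N](subnKC (dimvS (lcs_subvS i))).
rewrite mulnDl leq_add2r.
by apply: IHk; lia.
Qed.

(* For fixed x, y with [x, y] nonzero modulo gamma_3, the tensors
   [x, y] (x) z + [y, z] (x) x + [z, x] (x) y lie in the kernel of the map onto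
   P_2 / P_3, and vanish only when z is in <x, y> + [L, L]. *)
Lemma dim_span_derived_leq :
  ~~ (lcs L 1 <= lcs L 2)%VS ->
  (\dim (span_lcs 1) + d <=
     \dim (span_lcs 2) + (\dim (lcs L 1) - \dim (lcs L 2)) * d + 2)%N.
Proof.
move=> L12; have [f [g [T [fP gP TP step]]]] := lcs_chart 1.
have Lf x y : [lie x, y] \in lcs L 1 by rewrite (mem_lcsS 0) ?memvf.
have [x [y fxy]] : exists x y, f [lie x, y] != 0.
  apply: contraNP L12 => /forallNP fL; apply: bilinear_span_subv => x y _ _.
  by apply: fP (Lf x y) _; apply/eqP/negPn/negP => fxy; case: (fL x); exists y.
pose J z := (f [lie x, y])^T *m g z + (f [lie y, z])^T *m g x
  + (f [lie z, x])^T *m g y.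
have Jlin : linear J.
  move=> a v w; rewrite /J lie_linearl lie_linearr !linearP /=.
  by apply/matrixP=> i k; rewrite !(mxE, big_ord1); ring.
have Tmem u v : u \in lcs L 1 -> T ((f u)^T *m g v) - b u v \in span_lcs 2.
  by move=> /TP H; rewrite -opprB rpredN.
have {}step : (\dim (span_lcs 1) + \dim (limg (linfun J)) <=
    \dim (span_lcs 2) + (\dim (lcs L 1) - \dim (lcs L 2)) * d)%N.
  apply: step => M /memv_imgP[z _ ->].
  rewrite linfunE // !linearD /= -[X in X \in _]subr0 -(bcocycle x y z).
  rewrite opprD addrACA; apply: rpredD; last exact: Tmem.
  by rewrite opprD addrACA; apply: rpredD; apply: Tmem.
have kerJ : (lker (linfun J) <= <[x]> + <[y]> + derived L)%VS.
  apply/subvP => z; rewrite memv_ker linfunE // => /eqP Jz.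
  have [j fj] : exists j, f [lie x, y] 0 j != 0.
    apply: contraNP fxy => /forallNP f0; apply/eqP/rowP => j; rewrite mxE.
    by apply/eqP/negPn/negP/f0.
  (* Row [j] of [J z] is the value of [g] at [f [x, y]_j z + p x + q y]. As it vanishes, this vector
     lies in [derived L], and its first coefficient is invertible. *)
  set p := f [lie y, z] 0 j; set q := f [lie z, x] 0 j.
  have : f [lie x, y] 0 j *: z + p *: x + q *: y \in derived L.
    apply: gP; rewrite !linearD !linearZ /=; apply/rowP => k.
    have := congr1 (fun M => fun_of_matrix M j k) Jz.
    by rewrite !mxE !big_ord1 !mxE.
  set w := _ + _ => wL.
  have -> : z = (f [lie x, y] 0 j)^-1 *: (w - q *: y - p *: x).
    by rewrite /w !addrK scalerK.
  rewrite rpredZ // -addrA -opprD addrC memv_add // rpredN addrC.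
  by rewrite memv_add // rpredZ ?memv_line.
have := limg_ker_dim (linfun J) fullv; rewrite capfv.
have := dimvS kerJ; have := (dimv_add_leqif (<[x]> + <[y]>) (derived L)).1.
have := (dimv_add_leqif <[x]> <[y]>).1; rewrite !dim_vline.
move: (_ != _) (_ != _) => b1 b2; move: step; rewrite /d.
lia.
Qed.

(* With u = [x, y], the cocycle identity and b(u, u) = 0 put
   [u, x] (x) y - [u, y] (x) x in the kernel of the map onto P_3 / P_4;
   this tensor is nonzero when [u, x] is nonzero. *)
Lemma dim_span_lcs2_lt x y :
  [lie [lie x, y], x] \notin lcs L 3 ->
  (\dim (span_lcs 2) < \dim (span_lcs 3) +
     (\dim (lcs L 2) - \dim (lcs L 3)) * d)%N.
Proof.
move=> xyx; have [f [g [T [fP gP TP step]]]] := lcs_chart 2.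
have L2 z : [lie [lie x, y], z] \in lcs L 2.
  by rewrite (mem_lcsS 1) // (mem_lcsS 0) ?memvf.
have Tmem u v : u \in lcs L 2 -> T ((f u)^T *m g v) - b u v \in span_lcs 3.
  by move=> /TP H; rewrite -opprB rpredN.
pose M := (f [lie [lie x, y], x])^T *m g y - (f [lie [lie x, y], y])^T *m g x.
have TM : T M \in span_lcs 3.
  have := bcocycle [lie x, y] x y; rewrite balt addr0 (lieC y) linearNl /=.
  rewrite /M linearB -[X in X \in _]subr0 => <-.
  by rewrite opprD addrACA; apply: rpredD; rewrite -?opprD ?rpredN; apply: Tmem.
have Mneq0 : M != 0.
  apply: contra xyx => /eqP M0.
  have [[j fj]|f0] := pselect (exists j, f [lie [lie x, y], x] 0 j != 0);
      last first.
    apply: fP => //; apply/rowP => j; rewrite mxE.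
    by apply/eqP/negPn/negP => fj; apply: f0; exists j.
  have : f [lie [lie x, y], x] 0 j *: y - f [lie [lie x, y], y] 0 j *: x
      \in lcs L 1.
    apply: gP; rewrite linearB !linearZ /=; apply/rowP => k.
    have := congr1 (fun A => fun_of_matrix A j k) M0.
    by rewrite /M !(mxE, big_ord1) mulrN.
  (* Bracketing with [x] removes the [x] term, which puts [[x, y]] in [lcs L 2] and hence [[[x, y],
     x]] in [lcs L 3]. *)
  move=> /mem_lcsS => /(_ x).
  rewrite linearBl !linearZl_LR /= lie_alt scaler0 subr0.
  move=> ayx; apply: (mem_lcsS 2); rewrite lieC rpredN.
  by rewrite -[[lie y, x]](scalerK fj) rpredZ.
have := step <[M]>%VS; rewrite dim_vline Mneq0 addn1; apply.
by move=> _ /vlineP[a ->]; rewrite linearZ rpredZ.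
Qed.

(** The savings [d - 2] for P_2 / P_3 and [1] for P_3 / P_4 add up to [d - 1]; from P_4 on the crude
    bound suffices. *)
Lemma dim_cocycle_span_leq c : 3%N \notin [pchar K] ->
  nilpotent_of_class L c -> (3 <= c)%N ->
  (\dim (bilinear_span b fullv fullv) + d <=
     'C(d, 2) + \dim (derived L) * d + 1)%N.
Proof.
move=> char3 nilL le3c.
have [x [y xyx]] := exists_lie_lie_notin c char3 nilL le3c.
have P0 : (\dim (bilinear_span b fullv fullv) <=
    \dim (span_lcs 1) + 'C(d, 2))%N.
  apply: dim_alternating_span => // u v vL.
  by rewrite alternating_opp // rpredN (mem_span_lcs 1).
have P1 := dim_span_derived_leq (lcs_proper 1 c nilL (ltnW le3c)).
have P2 := dim_span_lcs2_lt x y xyx.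
have P3 := dim_span_lcs_leq c 3 nilL.1.
have telescope : (\dim (derived L) * d = (\dim (lcs L 1) - \dim (lcs L 2)) * d +
    (\dim (lcs L 2) - \dim (lcs L 3)) * d + \dim (lcs L 3) * d)%N.
  by rewrite -!mulnDl -addnA !subnK ?dimvS ?lcs_subvS.
rewrite telescope; move: P0 P1 P2 P3 {telescope}.
move: (_ * d)%N (_ * d)%N (_ * d)%N 'C(_, _) => r1 r2 r3 r0.
lia.
Qed.

End Cocycle.

Local Open Scope classical_set_scope.

(** * Subspaces given as predicates, and dimensions of their quotients *)

Section Subspace.
Context {K : fieldType} {V : lmodType K} {W : set V} (Wsub : subspace W).

Lemma subspaceD u v : W u -> W v -> W (u + v).
Proof. by move=> Wu Wv; rewrite -[u]scale1r; apply: Wsub.2. Qed.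

Lemma subspaceZ a u : W u -> W (a *: u).
Proof.
by move=> Wu; rewrite -[a *: u]addr0; apply: Wsub.2 => //; apply: Wsub.1.
Qed.

Lemma subspaceN u : W u -> W (- u).
Proof. by rewrite -scaleN1r; apply: subspaceZ. Qed.

Lemma subspaceB u v : W u -> W v -> W (u - v).
Proof. by move=> Wu Wv; apply: subspaceD => //; apply: subspaceN. Qed.

Lemma subspace_sum (I : finType) (h : I -> V) :
  (forall i, W (h i)) -> W (\sum_i h i).
Proof.
by move=> Wh; apply: big_ind => //; [apply: Wsub.1 | apply: subspaceD].
Qed.

End Subspace.

Lemma subspace_lie_prod {K : fieldType} {L : lieAlgType K} {A B : set L} :
  subspace (lie_prod A B).
Proof.
split=> [W [Wsub _]|a u v ABu ABv W [Wsub WAB]]; first exact: Wsub.1.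
by apply: Wsub.2; [apply: ABu | apply: ABv].
Qed.

Lemma mem_lie_prod {K : fieldType} {L : lieAlgType K} {A B : set L} x y :
  A x -> B y -> lie_prod A B [lie x, y].
Proof.
by move=> Ax By W [_ WAB]; apply: WAB; exists x => //; exists y.
Qed.

(** A [vspace] of largest dimension inside [W] is all of [W], since adjoining a vector of [W] cannot
    enlarge it. *)
Lemma subspace_vspace {K : fieldType} {V : vectType K} {W : set V} :
  subspace W -> exists U : {vspace V}, forall x, x \in U <-> W x.
Proof.
move=> Wsub.
pose dimW k :=
  `[< exists2 U : {vspace V}, \dim U = k & forall x, x \in U -> W x >].
have dimW0 : exists k, dimW k.
  exists 0%N; apply/asboolP; exists 0%VS; rewrite ?dimv0 // => x.
  by rewrite memv0 => /eqP->; apply: Wsub.1.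
have dimWle k : dimW k -> (k <= \dim {:V})%N.
  by move=> /asboolP[U <- _]; apply/dimvS/subvf.
case: (ex_maxnP dimW0 dimWle) => k /asboolP[U dimU UW] maxU.
exists U => x; split=> [/UW //|Wx].
have : dimW (\dim (U + <[x]>)).
  apply/asboolP; exists (U + <[x]>)%VS => // w.
  case/memv_addP=> u uU [_ /vlineP[a ->] ->].
  by apply: (subspaceD Wsub); [apply: UW | apply: subspaceZ].
move=> /maxU; rewrite -dimU (geq_leqif (dimv_leqif_sup (addvSl _ _))).
by move=> /subvP; apply; apply: (subvP (addvSr _ _)); apply: memv_line.
Qed.

Section QuotientDim.
Context {K : fieldType} {F : lmodType K} {A B : set F}.

(** The coordinates of the [v i] in the [v' j] form a [k] by [k'] matrix. It is row free: a row
    vector it kills is a second set of coordinates for [0]. Applied both ways, this makes the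
    dimension unique. *)
Lemma quotient_dim_leq k k' : A 0 -> subspace B ->
  quotient_dim A B k -> quotient_dim A B k' -> (k <= k')%N.
Proof.
move=> A0 Bsub [v [Av vP]] [v' [_ v'P]].
have /choice[c cP] i : exists c : 'rV[K]_k', B (v i - \sum_j c 0 j *: v' j).
  by have [c [Bc _]] := v'P _ (Av i); exists c.
pose M := \matrix_i c i.
suff /eqP rM : row_free M by have := rank_leq_col M; rewrite rM.
apply: inj_row_free => a aM0; have [a' [_ a'P]] := vP _ A0.
rewrite -(a'P 0) => [|]; last first.
  by rewrite big1 ?subr0 => [|i _]; rewrite ?mxE ?scale0r //; apply: Bsub.1.
apply/esym/a'P; rewrite sub0r; apply: (subspaceN Bsub).
have -> : \sum_i a 0 i *: v i =
    \sum_i a 0 i *: (v i - \sum_j c i 0 j *: v' j).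
  under [RHS]eq_bigr do rewrite scalerBr.
  rewrite big_split /= sumrN -[LHS]subr0; congr (_ - _); apply/esym.
  under eq_bigr do rewrite scaler_sumr.
  rewrite exchange_big big1 //= => j _.
  under eq_bigr do rewrite scalerA.
  rewrite -scaler_suml; have := congr1 (fun N => fun_of_matrix N 0 j) aM0.
  rewrite !mxE; under eq_bigr do rewrite mxE.
  by move=> ->; rewrite scale0r.
by apply: (subspace_sum Bsub) => i; apply: (subspaceZ Bsub); apply: cP.
Qed.

(** [phi] induces an isomorphism from [U / N] onto [A / B], which reduces a quotient inside a
    possibly infinite-dimensional [F] to [vspace]s. *)
Lemma quotient_dim_image (V : vectType K) (phi : V -> F) (U N : {vspace V}) :
  subspace A -> subspace B -> B `<=` A -> linear phi ->
  (forall x, A x -> exists w, B (x - phi w)) ->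
  (forall w, w \in U <-> A (phi w)) -> (forall w, w \in N <-> B (phi w)) ->
  quotient_dim A B (\dim U - \dim N).
Proof.
move=> Asub Bsub BA philin phi_onto UA NB.
have NU : (N <= U)%VS by apply/subvP => w /NB/BA/UA.
have dimC : \dim (U :\: N) = (\dim U - \dim N)%N.
  by have := dimv_cap_compl U N; rewrite (capv_idPr NU) => <-; rewrite addKn.
have phi0 : phi 0 = 0.
  by have := philin (-1) 0 0; rewrite scaler0 addr0 scaleN1r addNr.
have phi_sum n (c : 'I_n -> K) (w : 'I_n -> V) :
    phi (\sum_i c i *: w i) = \sum_i c i *: phi (w i).
  apply: (big_ind2 (fun w x => phi w = x)) => // [w1 x1 w2 x2 <- <-|i _].
    by have := philin 1 w1 w2; rewrite !scale1r.
  by have := philin (c i) (w i) 0; rewrite phi0 !addr0.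
have phiB w1 w2 : phi (w1 - w2) = phi w1 - phi w2.
  by have := philin (-1) w2 w1; rewrite !scaleN1r ![- _ + _]addrC.
rewrite -dimC; exists (fun i => phi (vbasis (U :\: N))`_i); split=> [i|x Ax].
  apply/UA; apply: (subvP (diffvSl U N)); apply: vbasis_mem.
  by rewrite mem_nth ?size_tuple.
have [w Bw] := phi_onto x Ax.
have wU : w \in U.
  apply/UA; rewrite -[phi w](subKr x) -opprB opprB.
  by apply: (subspaceB Asub) => //; apply: BA.
have wUN : w \in (U :\: N + N)%VS by rewrite addv_diff (subvP (addvSl _ _)).
have [u uU [v vN wE]] := memv_addP wUN.
exists (\row_i coord (vbasis (U :\: N)) i u); split=> [|c Bc].
  under eq_bigr do rewrite mxE.
  rewrite -phi_sum -(coord_vbasis uU) -[x](subrK (phi w)) -addrA -phiB.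
  apply: (subspaceD Bsub) => //; apply/NB.
  by rewrite wE addrAC subrr add0r.
have uc : u - \sum_i c 0 i *: (vbasis (U :\: N))`_i \in N.
  apply/NB; rewrite phiB phi_sum.
  have -> : u = w - v by rewrite wE addrK.
  rewrite phiB addrAC -[phi w](subrK x) -opprB -(addrA _ x).
  apply: (subspaceB Bsub); last exact/NB.
  by rewrite addrC; apply: (subspaceB Bsub).
have {}uc : u = \sum_i c 0 i *: (vbasis (U :\: N))`_i.
  apply/eqP; rewrite -subr_eq0 -memv0 -(capv_diff U N) memv_cap uc andbT.
  rewrite rpredB //; apply: rpred_sum => i _.
  by rewrite rpredZ // vbasis_mem // mem_nth ?size_tuple.
apply/rowP => i; rewrite mxE uc coord_sum_free //.
exact: (basis_free (vbasisP _)).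
Qed.

End QuotientDim.

(** * The cocycle attached to a free presentation *)

Section Presentation.
Context {K : fieldType} {F : lieAlgType K} {L : fdLieAlgType K} {p : F -> L}.
Context (pM : lie_morphism p) (p_surj : forall y, exists x, p x = y).

Let R : set F := [set x | p x = 0].
Let RF : set F := lie_prod R setT.
Let F2 : set F := lie_prod setT setT.
Let n := \dim {:L}.
Let e (i : 'I_n) : L := (vbasis fullv)`_i.

Lemma lie_morphismB x y : p (x - y) = p x - p y.
Proof.
by have := pM.1 (-1) y x; rewrite !scaleN1r ![- _ + _]addrC.
Qed.

Lemma lie_morphism_sum (I : finType) (c : I -> K) (h : I -> F) :
  p (\sum_i c i *: h i) = \sum_i c i *: p (h i).
Proof.
have p0 : p 0 = 0 by rewrite -(subrr 0) lie_morphismB subrr.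
apply: (big_ind2 (fun x y => p x = y)) => // [x1 y1 x2 y2 <- <-|i _].
  by have := pM.1 1 x1 x2; rewrite !scale1r.
by have := pM.1 (c i) (h i) 0; rewrite p0 !addr0.
Qed.

Lemma subspace_ker : subspace R.
Proof.
have p0 : p 0 = 0 by rewrite -(subrr 0) lie_morphismB subrr.
by split=> // a u v; rewrite /R /= pM.1 => -> ->; rewrite scaler0 addr0.
Qed.

Lemma lie_prod_ker_sub : RF `<=` R.
Proof.
apply: smallest_sub; first exact: subspace_ker.
by move=> _ [r r0 [x _ <-]]; rewrite /R /= pM.2 r0 linear0l.
Qed.

Lemma lie_prod_ker_sub_derived : RF `<=` F2.
Proof.
apply: smallest_sub; first exact: subspace_lie_prod.
by move=> _ [r _ [x _ <-]]; apply: mem_lie_prod.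
Qed.

Lemma lie_section_congr x x' y y' :
  R (x - x') -> R (y - y') -> RF ([lie x, y] - [lie x', y']).
Proof.
move=> xx' yy'.
(* The second difference is turned around because [RF] is generated by brackets with the element of
   [R] on the left. *)
have -> : [lie x, y] - [lie x', y'] = [lie x - x', y] - [lie y - y', x'].
  rewrite [ [lie y - y', x'] ]lieC opprK linearBl linearBr /=.
  by rewrite addrA subrK.
by apply: (subspaceB subspace_lie_prod); apply: mem_lie_prod.
Qed.

(** A finite-dimensional model of [F2 / RF]: matrices stand for the tensor square of [L], [phi]
    sends them to brackets of lifts, and [N] is the preimage of [RF]. The multiplier is then
    [lker psi / N]. *)
Lemma schur_multiplier_cocycle :
  exists (b : {bilinear L -> L -> 'M[K]_n}) (k : nat),
  [/\ forall x, b x x = 0,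
      forall x y z, b [lie x, y] z + b [lie y, z] x + b [lie z, x] y = 0,
      quotient_dim (R `&` F2) RF k &
      (k + \dim (derived L) <= \dim (bilinear_span b fullv fullv))%N].
Proof.
have /choice[t tE] : forall i, exists x, p x = e i by move=> i; apply: p_surj.
pose s x := \sum_i coord (vbasis fullv) i x *: t i.
have ps x : p (s x) = x.
  rewrite lie_morphism_sum {2}(coord_vbasis (memvf x)).
  by apply: eq_bigr => i _; rewrite tE.
pose phi (M : 'M[K]_n) := \sum_i \sum_j M i j *: [lie t i, t j].
have philin : linear phi.
  move=> a M1 M2; rewrite scaler_sumr -big_split /=; apply: eq_bigr => i _.
  rewrite scaler_sumr -big_split /=; apply: eq_bigr => j _.
  by rewrite !mxE scalerDl scalerA.
have phi0 : phi 0 = 0.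
  by have := philin (-1) 0 0; rewrite scaler0 addr0 scaleN1r addNr.
pose tens (x y : L) : 'M[K]_n :=
  \matrix_(i, j) (coord (vbasis fullv) i x * coord (vbasis fullv) j y).
have phi_tens x y : phi (tens x y) = [lie s x, s y].
  rewrite linear_sumlz; apply: eq_bigr => i _.
  rewrite linear_sumr; apply: eq_bigr => j _.
  by rewrite linearZl_LR linearZr_LR /= mxE scalerA.
have preim_sub (B : set F) : subspace B -> subspace [set M | B (phi M)].
  move=> Bsub; split=> [|a u v] /=; last by rewrite philin; apply: Bsub.2.
  by rewrite phi0; apply: Bsub.1.
have [N NP] := subspace_vspace (preim_sub RF subspace_lie_prod).
pose psi := linfun (fun M => p (phi M)).
have psiE M : psi M = p (phi M).
  by rewrite linfunE // => a M1 M2; rewrite philin pM.1.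
have phiF2 M : F2 (phi M).
  apply: (subspace_sum subspace_lie_prod) => i.
  apply: (subspace_sum subspace_lie_prod) => j.
  by apply: (subspaceZ subspace_lie_prod); apply: mem_lie_prod.
have limg_psi : limg psi = derived L.
  apply/eqP; rewrite eqEsubv; apply/andP; split.
    apply/subvP => _ /memv_imgP[M _ ->]; rewrite psiE.
    have : F2 (phi M) := phiF2 M.
    move: (phi M); apply: smallest_sub.
      split=> [|a u v] /=.
        by rewrite subspace_ker.1 mem0v.
      by rewrite pM.1 => uL vL; rewrite rpredD ?rpredZ.
    by move=> _ [x _ [y _ <-]]; rewrite /= pM.2 mem_bilinear_span ?memvf.
  apply: bilinear_span_subv => x y _ _.
  have : psi (tens x y) \in limg psi by rewrite memv_img ?memvf.
  by rewrite psiE phi_tens pM.2 !ps.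
(* The kernel of [pi] is [N], so its image is a copy of [F2 / RF] among the matrices. *)
pose pi := (\1 - projv N)%VF.
have piE M : (pi M == 0) = (M \in N).
  rewrite /pi add_lfunE opp_lfunE id_lfunE subr_eq0; apply/eqP/idP => [->|].
    exact: memv_proj.
  by move/projv_id.
have tens_linear : bilinear_for *:%R *:%R (fun x y => pi (tens x y)).
  split=> [y a u v|x a u v]; rewrite -linearP; congr (pi _);
    apply/matrixP => i j; rewrite !mxE linearP /=; ring.
pose bm := bilinear_isBilinear.Build K L L 'M[K]_n *:%R *:%R
  (fun x y => pi (tens x y)) tens_linear.
pose b : {bilinear L -> L -> 'M[K]_n} := HB.pack (fun x y => pi (tens x y)) bm.
have bE x y : b x y = pi (tens x y) by [].
exists b, (\dim (lker psi) - \dim N)%N.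
have s_lie x y : R (s [lie x, y] - [lie s x, s y]).
  by rewrite /R /= lie_morphismB pM.2 !ps subrr.
split=> [x|x y z||].
- apply/eqP; rewrite bE piE; apply/NP => /=.
  by rewrite phi_tens lie_alt; apply: subspace_lie_prod.1.
- rewrite !bE -!linearD; apply/eqP; rewrite piE; apply/NP => /=.
  have phiD M1 M2 : phi (M1 + M2) = phi M1 + phi M2.
    by have := philin 1 M1 M2; rewrite !scale1r.
  (* The Jacobi identity of the lifts is subtracted, and each term is compared with its counterpart
     modulo [RF]. *)
  rewrite !phiD !phi_tens -[X in RF X]subr0.
  rewrite -(lie_jacobi_left (s x) (s y) (s z)).
  have Rs u : R (s u - s u) by rewrite subrr; apply: subspace_ker.1.
  rewrite opprD addrACA; apply: (subspaceD subspace_lie_prod).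
    rewrite opprD addrACA; apply: (subspaceD subspace_lie_prod);
      exact: lie_section_congr.
  exact: lie_section_congr.
- apply: (quotient_dim_image _ phi (lker psi) N) => //.
  + split=> [|a u v [Ru Fu] [Rv Fv]].
      by split; [apply: subspace_ker.1 | apply: subspace_lie_prod.1].
    by split; [apply: subspace_ker.2 | apply: subspace_lie_prod.2].
  + exact: subspace_lie_prod.
  + move=> x RFx.
    by split; [apply: lie_prod_ker_sub | apply: lie_prod_ker_sub_derived].
  + move=> x [_]; move: x; apply: smallest_sub.
      split=> [|a u v [M uM] [M' vM']] /=.
        by exists 0; rewrite phi0 subr0; apply: subspace_lie_prod.1.
      exists (a *: M + M'); rewrite philin opprD addrACA -scalerBr.
      exact: subspace_lie_prod.2.
    move=> _ [u _ [v _ <-]]; exists (tens (p u) (p v)); rewrite phi_tens.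
    by apply: lie_section_congr; rewrite /R /= lie_morphismB ps subrr.
  + move=> M; rewrite memv_ker psiE; split=> [/eqP //|[RM _]]; exact/eqP.
(* Rank-nullity for [psi] and [pi] gives [\dim (limg pi) = k + \dim (derived L)]; elementary
   matrices are tensors of basis vectors, so [limg pi] lies in the span of [b]. *)
have dim_psi := limg_ker_dim psi fullv.
rewrite capfv limg_psi in dim_psi.
have dim_pi := limg_ker_dim pi fullv.
have lker_pi : lker pi = N by apply/vspaceP => M; rewrite memv_ker piE.
rewrite capfv lker_pi in dim_pi.
have : (limg pi <= bilinear_span b fullv fullv)%VS.
  apply/subvP => _ /memv_imgP[M _ ->].
  rewrite [M]matrix_sum_delta linear_sum; apply: rpred_sum => i _.
  rewrite linear_sum; apply: rpred_sum => j _; rewrite linearZ rpredZ //.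
  have -> : delta_mx i j = tens (e i) (e j).
    apply/matrixP => i' j'; rewrite !mxE.
    rewrite !coord_free ?(basis_free (vbasisP _)) //.
    by rewrite -natrM mulnb eq_sym [j' == j]eq_sym.
  have := mem_bilinear_span b _ _ _ _ (memvf (e i)) (memvf (e j)).
  by rewrite bE.
move=> /dimvS.
have : (N <= lker psi)%VS.
  apply/subvP => M /NP/lie_prod_ker_sub RM; rewrite memv_ker psiE.
  exact/eqP.
move=> /dimvS.
move: dim_psi dim_pi; rewrite !dimvf.
move: (\dim (lker psi)) (\dim N) (\dim (bilinear_span _ _ _)) => k1 k2 k3.
lia.
Qed.

End Presentation.

(* Characteristic 3 is excluded because the claim fails there: the algebra with
   basis x, y, z, a, b, c, k and nonzero brackets a = [x, y], b = [y, z],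
   c = [z, x], [a, z] = [b, x] = [c, y] = k has class 3, n = 7, m = 4 and a
   Schur multiplier of dimension 10 = (n + m - 2) (n - m - 1) / 2 + 1. *)
Theorem theorem2p24 (K : fieldType) (char_neq3 : 3%N \notin [pchar K]) :
  (~ exists (L : fdLieAlgType K) (c n m k : nat) (P : free_presentation L),
       [/\ nilpotent_of_class L c, (3 <= c)%N,
           n = \dim {:L} & m = \dim (derived L)] /\
       schur_multiplier_dim P k /\
       k%:Q = 2^-1 * (n%:Q + m%:Q - 2) * (n%:Q - m%:Q - 1) + 1) /\
  (forall (L : fdLieAlgType K) (c n m : nat) (P : free_presentation L),
     nilpotent_of_class L c -> (3 <= c)%N ->
     n = \dim {:L} -> m = \dim (derived L) ->
     exists k : nat, schur_multiplier_dim P k /\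
       k%:Q <= 2^-1 * (n%:Q + m%:Q - 2) * (n%:Q - m%:Q - 1)).
Proof.
set stmt2 := (X in _ /\ X).
(* By uniqueness of the dimension, the inequality excludes the value one above the bound. *)
suff S2 : stmt2.
  split=> // -[L [c [n [m [k [P [[nilL le3c nE mE] [kP kE]]]]]]]].
  have [k' [k'P]] := S2 L c n m P nilL le3c nE mE.
  have -> : k' = k.
    have PA : (fp_ker P `&` lie_prod setT setT) 0.
      split; first exact: (subspace_ker (fp_morphism P)).1.
      exact: subspace_lie_prod.1.
    apply/eqP; rewrite eqn_leq; apply/andP; split.
      exact: (quotient_dim_leq _ _ PA subspace_lie_prod k'P kP).
    exact: (quotient_dim_leq _ _ PA subspace_lie_prod kP k'P).
  rewrite kE; lra.
move=> L c n m P nilL le3c -> ->.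
have [b [k [balt bcocycle kP kle]]] :=
  schur_multiplier_cocycle (fp_morphism P) (fp_surj P).
exists k; split=> //.
have := dim_cocycle_span_leq b balt bcocycle c char_neq3 nilL le3c.
have := dimvS (subvf (derived L)); move: kle.
move: (\dim (bilinear_span _ _ _)) => q {b balt bcocycle}.
move: (\dim {:L}) (\dim (derived L)) => n' m'.
move=> kle /subnKC <-; move: (n' - m')%N => d; rewrite addKn => qle.
(* With [n' = m' + d] the announced bound equals ['C(d, 2) + m' d + 1 - m' - d]; this identity
   clears the binomial without truncated subtraction. *)
have bin2E : (2 * 'C(d, 2) + d = d * d)%N.
  elim: d {qle} => // d IHd; rewrite binS bin1; lia.
have := leq_trans (leq_add kle (leqnn d)) qle.
rewrite -(Num.Theory.ler_nat rat) !natrD natrM => le_k.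
have {}bin2E := congr1 (fun i : nat => i%:R : rat) bin2E.
rewrite /= natrD !natrM in bin2E.
rewrite !pmulrn; nra.
Qed.
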